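(* Let $\lambda>-1$, and for $t\in\mathbb{R}$ let $\beta_n=\beta_n(t;\lambda)$ be the recurrence coefficients of the monic orthogonal polynomials for the generalised sextic Freud weight $\omega(x;t,\lambda)=|x|^{2\lambda+1}\exp(-x^6+tx^2)$, $x\in\mathbb{R}$. Then, for every integer $n\ge0$, $\beta_n$ and $\beta_{n+1}$, as functions of $t$, satisfy the system \begin{align*} &\frac{d^2\beta_n}{dt^2}-3(\beta_n+\beta_{n+1})\frac{d\beta_n}{dt}+\beta_n^3+6\beta_n^2\beta_{n+1}+3\beta_n\beta_{n+1}^2-\tfrac13t\beta_n=\tfrac16(n+\gamma_n),\\ &\frac{d^2\beta_{n+1}}{dt^2}+3(\beta_n+\beta_{n+1})\frac{d\beta_{n+1}}{dt}+\beta_{n+1}^3+6\beta_{n+1}^2\beta_n+3\beta_{n+1}\beta_n^2-\tfrac13t\beta_{n+1}=\tfrac16(n+1+\gamma_{n+1}), \end{align*} with $\gamma_n=(\lambda+\tfrac12)[1-(-1)^n]$.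
   Context: The weight is symmetric, so the monic orthogonal polynomials $P_n$ (with $\int_{-\infty}^\infty P_mP_n\,\omega\,dx=h_n\delta_{m,n}$, $h_n>0$) satisfy $P_{n+1}(x)=xP_n(x)-\beta_n(t;\lambda)P_{n-1}(x)$ with $P_{-1}=0$, $P_0=1$; here $\beta_n=h_n/h_{n-1}$ for $n\ge1$, and by convention $\beta_0=0$. *)

(* Defs.v *)
From HB Require Import structures.
From mathcomp Require Import all_boot all_order all_algebra.
From mathcomp Require Import all_classical all_reals all_analysis.

Set Implicit Arguments.
Unset Strict Implicit.
Unset Printing Implicit Defensive.

Import Order.TTheory GRing.Theory Num.Theory.
Import numFieldNormedType.Exports.

Local Open Scope ring_scope.

(* [powR] is total: for 2 * lam + 1 < 0 the weight takes the value 0 at x = 0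
   instead of being infinite there, which no integral sees. *)
Definition freud_weight (R : realType) (lam t x : R) : R :=
  `|x| `^ (2 * lam + 1) * expR (- x ^+ 6 + t * x ^+ 2).

Definition monic_orthogonal (R : realType) (w : R -> R)
    (P : nat -> {poly R}) (h : nat -> R) : Prop :=
  (forall n, P n \is monic /\ size (P n) = n.+1) /\
  (forall n, 0 < h n) /\
  (forall m n,
    \int[@lebesgue_measure R]_x ((P m).[x] * (P n).[x] * w x) =
    h n * (m == n)%:R).

(* The convention P_{-1} = 0 appears as the separate equation P_1 = x P_0. *)
Definition recurrence_coefficients (R : realType)
    (P : nat -> {poly R}) (b : nat -> R) : Prop :=
  b 0%N = 0 /\
  P 0%N = 1 /\
  P 1%N = 'X * P 0%N /\
  (forall n, P n.+2 = 'X * P n.+1 - b n.+1 *: P n).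

Definition freud_gamma (R : realType) (lam : R) (n : nat) : R :=
  (lam + 2^-1) * (1 - (-1) ^+ n).

Definition twice_derivable (R : realType) (f : R -> R) : Prop :=
  forall t : R, derivable f t 1 /\ derivable (derive1 f) t 1.

(* Main.v *)
(** Let L_t be integration against the weight.  Two analytic facts suffice:
    d/dt L_t(p) = L_t(x^2 p), and, integrating the derivative of x p w,
    L_t(x p') + (2 lam + 2) L_t(p) = 6 L_t(x^6 p) - 2 t L_t(x^2 p).
    The first gives h_n' = (beta_n + beta_{n+1}) h_n, since dP_n/dt has degree
    less than n, hence the Volterra equation
    beta_n' = beta_n (beta_{n+1} - beta_{n-1}).  The second with p = P_n^2 gives
    V_n + V_{n+1} = 2 n + 2 lam + 2, where V_n is the left-hand side of the
    discrete equation V_n = n + gamma_n; as V_0 = 0, the latter follows by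
    induction.  Eliminating beta_{n-2}, beta_{n-1}, beta_{n+2} between the two is
    the claimed system. *)
Require Import Defs.
From HB Require Import structures.
From mathcomp Require Import all_boot all_order all_algebra.
From mathcomp Require Import all_classical all_reals all_analysis.
From mathcomp Require Import measurable_realfun.
From mathcomp Require Import zify ring lra.
Import Order.TTheory GRing.Theory Num.Theory.
Import numFieldNormedType.Exports.
Local Open Scope ring_scope.

Set Implicit Arguments.
Unset Strict Implicit.
Unset Printing Implicit Defensive.

(** * Integration of derivatives on the line without the origin *)

Section punctured_line.
Local Open Scope classical_set_scope.
Context {R : realType}.
Let mu := @lebesgue_measure R.
Implicit Types (F f : R -> R) (r : R).

(** A compact set that avoids 0, where the weight may be singular. As [r] grows these sets exhaust
    the punctured line, so the fundamental theorem of calculus is applied on them before passing to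
    the limit. *)
Definition annulus r : set R := `[- r, - r^-1] `|` `[r^-1, r].

Lemma annulusP r x : 0 < r -> annulus r x <-> r^-1 <= `|x| <= r.
Proof.
move=> r0; have ri0 : 0 < r^-1 by rewrite invr_gt0.
rewrite /annulus /= !in_itv /=; have [x0|x0] := lerP 0 x.
  by rewrite ger0_norm//; split=> [[/andP[]|//]|]; [lra|right].
by rewrite ltr0_norm//; split=> [[/andP[]|/andP[]]|]; [lra..|left; lra].
Qed.

Lemma measurable_annulus r : measurable (annulus r).
Proof. exact: measurableU. Qed.

Lemma is_derive_continuous f (x df : R) :
  is_derive x 1 f df -> {for x, continuous f}.
Proof.
move=> [fx _]; apply: differentiable_continuous.
exact/derivable1_diffP.
Qed.

Lemma integral_derivative F f (a b : R) : a < b ->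
  (forall x, a <= x <= b -> is_derive x 1 F (f x)) ->
  (forall x, a <= x <= b -> {for x, continuous f}) ->
  (\int[mu]_(x in `[a, b]) (f x)%:E = (F b - F a)%:E)%E.
Proof.
move=> ab dF cf; rewrite EFinB; apply: continuous_FTC2 => //.
- apply: continuous_in_subspaceT => x; rewrite inE /= in_itv /=; exact: cf.
- have cF x : a <= x <= b -> {for x, continuous F}.
    by move=> /dF /is_derive_continuous.
  split; last 2 first.
  + by apply: cvg_at_right_filter; apply: cF; rewrite lexx ltW.
  + by apply: cvg_at_left_filter; apply: cF; rewrite lexx ltW.
  + move=> x; rewrite in_itv /= => /andP[ax xb].
    by have [] := dF x; rewrite ?ltW.
- move=> x; rewrite in_itv /= => /andP[ax xb]; rewrite derive1E.
  by have [|_ ->] := dF x; rewrite ?ltW.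
Qed.

Lemma integral_annulus F f r : 1 < r -> measurable_fun setT f ->
  (forall x : R, x != 0 -> is_derive x 1 F (f x)) ->
  (forall x : R, x != 0 -> {for x, continuous f}) ->
  (\int[mu]_(x in annulus r) (f x)%:E
    = (F (- r^-1) - F (- r) + (F r - F r^-1))%:E)%E.
Proof.
move=> r1 mf dF cf.
have r0 : 0 < r by lra.
have ri0 : 0 < r^-1 by rewrite invr_gt0.
have rir : r^-1 < r by rewrite (lt_trans _ r1)// invf_lt1.
rewrite integral_setU//=; last 2 first.
- by apply/measurable_EFinP; exact: measurable_funTS.
- apply/disj_setPS => x [] /=; rewrite !in_itv /=; lra.
rewrite EFinD; congr (_ + _)%E.
  apply: integral_derivative; rewrite ?ltrN2// => x xr; [apply: dF|apply: cf].
    by rewrite lt_eqF//; lra.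
  by rewrite lt_eqF//; lra.
apply: integral_derivative; rewrite // => x xr; [apply: dF|apply: cf].
  by rewrite gt_eqF//; lra.
by rewrite gt_eqF//; lra.
Qed.

(** Starting at 2 keeps the radius above 1, so that both intervals of the annulus are nondegenerate,
    as [integral_annulus] requires. *)
Let rad (n : nat) : R := n.+2%:R.

Let rad_gt1 n : 1 < rad n. Proof. by rewrite ltr1n. Qed.

Let rad_gt0 n : 0 < rad n. Proof. by rewrite ltr0n. Qed.

Let annulus_near (x : R) : x != 0 -> \forall n \near \oo, annulus (rad n) x.
Proof.
move=> x0; near=> n; apply/annulusP => //.
have nx0 : 0 < `|x| by rewrite normr_gt0.
have key : Num.max `|x| `|x|^-1 <= rad n.
  rewrite /rad -natr1 -natr1; apply: (@le_trans _ _ n%:R); last by lra.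
  by near: n; exact: nbhs_infty_ger.
move: key; rewrite ge_max => /andP[xr xr']; rewrite xr andbT.
by rewrite -[`|x|]invrK lef_pV2 ?posrE ?invr_gt0.
Unshelve. all: end_near. Qed.

(** Monotone convergence along the annuli: the integral of [f] over each is a combination of values
    of [F], hence bounded uniformly. *)
Lemma bounded_primitive_integrable F f M :
  measurable_fun setT f -> (forall x, 0 <= f x) ->
  (forall x : R, x != 0 -> is_derive x 1 F (f x)) ->
  (forall x : R, x != 0 -> {for x, continuous f}) ->
  (forall x, `|F x| <= M) -> mu.-integrable setT (EFin \o f).
Proof.
move=> mf f0 dF cf FM.
have mEf : measurable_fun setT (EFin \o f) by exact/measurable_EFinP.
have cover : \bigcup_n annulus (rad n) = [set~ 0].
  apply/seteqP; split=> [x [n _]|x /= /eqP x0].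
    move=> /(annulusP _ (rad_gt0 n)) /andP[+ _] /= x0; rewrite x0 normr0.
    by rewrite leNgt invr_gt0 rad_gt0.
  by have [N _ /(_ N (leqnn _)) xN] := annulus_near x0; exists N.
(* Nothing is known about [F] at 0, so this null set is removed. *)
apply/(@negligible_integrable _ _ _ mu setT [set 0]) => //.
  exact: lebesgue_measure_set1.
rewrite setTD; apply/integrableP; split; first exact: measurable_funTS.
rewrite -cover.
under eq_integral => x _ do rewrite gee0_abs ?lee_fin//.
(* Each annulus has four endpoints, and each value of [F] is at most [M] in size. *)
apply: (@le_lt_trans _ _ (4 * M)%:E); last exact: ltry.
have cvgI : (\int[mu]_(x in annulus (rad n)) (EFin \o f) x)%E @[n --> \oo]
    --> (\int[mu]_(x in \bigcup_n annulus (rad n)) (EFin \o f) x)%E.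
  apply: ge0_nondecreasing_set_cvg_integral.
  - move=> m n mn; apply/subsetPset => x.
    move=> /(annulusP _ (rad_gt0 m)) /andP[x1 x2]; apply/annulusP => //.
    have rmn : rad m <= rad n by rewrite ler_nat.
    rewrite (le_trans x2 rmn) andbT (le_trans _ x1)// lef_pV2 ?posrE//.
  - by move=> n; exact: measurable_annulus.
  - by move=> n; exact: measurable_funTS.
  - by move=> n x _; rewrite /= lee_fin.
rewrite -(cvg_lim _ cvgI)//; apply: lime_le; first exact: cvgP cvgI.
apply: nearW => n; rewrite (integral_annulus _ mf dF cf)// lee_fin.
have bd x : - M <= F x <= M by rewrite -ler_norml.
by move: (bd (- (rad n)^-1)) (bd (- rad n)) (bd (rad n)) (bd (rad n)^-1); lra.
Qed.

(** Dominated convergence along the annuli, with [|f|] as the dominating function; the four boundary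
    terms vanish in the limit. *)
Lemma integral_derivative_eq0 F f :
  mu.-integrable setT (EFin \o f) ->
  (forall x : R, x != 0 -> is_derive x 1 F (f x)) ->
  (forall x : R, x != 0 -> {for x, continuous f}) ->
  F n.+2%:R @[n --> \oo] --> 0 -> F (- n.+2%:R) @[n --> \oo] --> 0 ->
  F n.+2%:R^-1 @[n --> \oo] --> 0 -> F (- n.+2%:R^-1) @[n --> \oo] --> 0 ->
  \int[mu]_x f x = 0.
Proof.
move=> intf dF cf Fy FNy F0 FN0.
have mf : measurable_fun setT f by apply/measurable_EFinP; case/integrableP: intf.
pose D : set R := ~` [set 0].
have m0 : measurable D by exact: measurableC.
have int0 : mu.-integrable D (EFin \o f).
  exact: integrableS intf.
rewrite /Rintegral (@negligible_integral _ _ _ mu _ [set 0])//; last first.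
  exact: lebesgue_measure_set1.
rewrite setTD -/D.
have cv : (\int[mu]_(x in D) ((EFin \o f) \_ (annulus (rad n))) x)%E
    @[n --> \oo] --> (\int[mu]_(x in D) (EFin \o f) x)%E.
  apply: (@dominated_cvg _ _ _ mu _ m0 _ _ (fun x => `|f x|%:E)).
  - move=> n; apply: measurable_funTS; apply/(measurable_restrictT _ _).1.
      exact: measurable_annulus.
    by apply: measurable_funTS; exact/measurable_EFinP.
  - move=> x /= /eqP x0; apply: cvg_near_cst.
    near=> n; rewrite patchE mem_set//; near: n; exact: annulus_near.
  - by [].
  - exact: integrable_norm int0.
  - move=> n x _; rewrite /= patchE.
    by case: ifP => _; rewrite ?lee_fin//= normr0.
have E n : (\int[mu]_(x in D) ((EFin \o f) \_ (annulus (rad n))) x =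
    (F (- (rad n)^-1) - F (- rad n) + (F (rad n) - F (rad n)^-1))%:E)%E.
  rewrite -(integral_annulus _ mf dF cf)// -integral_mkcondr.
  congr (integral mu _ _); apply/setIidPr => x.
  move=> /(annulusP _ (rad_gt0 n)) /andP[+ _] /= x0; rewrite x0 normr0.
  by rewrite leNgt invr_gt0 rad_gt0.
have lim0 : (F (- (rad n)^-1) - F (- rad n) + (F (rad n) - F (rad n)^-1))%:E
    @[n --> \oo] --> 0%:E.
  apply: cvg_EFin; first exact: nearW.
  rewrite -[X in _ --> X](_ : 0 - 0 + (0 - 0) = 0); last by rewrite subrr addr0.
  by apply: cvgD; apply: cvgB.
rewrite (eq_cvg _ _ E) in cv.
by rewrite -(cvg_unique _ lim0 cv).
Unshelve. all: end_near. Qed.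

End punctured_line.

(** * Integrability of the weight against polynomials, and bounds for boundary terms *)

Section weight.
Local Open Scope classical_set_scope.
Context {R : realType}.
Let mu := @lebesgue_measure R.
Implicit Types (x t : R) (q : {poly R}).

(** Writing [|y|^a] as [(y^2)^(a/2)] avoids a case distinction on the sign of [x]. *)
Lemma is_derive_normr_powR (a : R) x : x != 0 ->
  is_derive x 1 (fun y => `|y| `^ a) (a * `|x| `^ a / x).
Proof.
move=> x0; have sqE y : `|y| `^ a = (y ^+ 2) `^ (a / 2).
  by rewrite -real_normK ?num_real// -powR_mulrn// -powRrM mulrC divfK.
rewrite [X in is_derive _ _ X _](_ : _ =
    (@powR R ^~ (a / 2)) \o (fun y : R => y ^+ 2)); last exact/funext.
have x2 : 0 < x ^+ 2 by rewrite exprn_even_gt0.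
have dX : is_derive x 1 (fun y : R => y ^+ 2) (2 * x).
  apply: is_derive_eq (is_deriveX 2 (is_derive_id x 1)) _.
  by rewrite /GRing.scale /= mulr1 expr1 mulr_natl.
have d := @is_derive1_comp R (@powR R ^~ (a / 2)) (fun y => y ^+ 2) x _ _
  (@is_derive1_powR R (a / 2) _ x2) dX.
apply: is_derive_eq d _.
rewrite powRB; last by apply/implyP => _; rewrite gt_eqF.
rewrite sqE powRr1 ?ltW//; field; exact: x0.
Qed.

Lemma sextic_bounded t : exists C, forall x, expR (- x ^+ 6 + t * x ^+ 2) <= C.
Proof.
(* With [y = x^2] and [c = |t|], the exponent is at most [- y^3 + c y]. If [y <= 1 + c], drop the
   cube; otherwise [c y <= y^3]. *)
exists (expR (`|t| * (1 + `|t|))) => x; rewrite ler_expR.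
have : 0 <= x ^+ 2 by rewrite sqr_ge0.
have -> : x ^+ 6 = (x ^+ 2) ^+ 3 by rewrite -exprM.
move: (x ^+ 2) => y y0; have t0 : 0 <= `|t| by [].
apply: (@le_trans _ _ (- y ^+ 3 + `|t| * y)).
  by rewrite lerD2l ler_wpM2r// ler_norm.
move: `|t| t0 => c c0; have [yc|cy] := lerP y (1 + c).
  have : 0 <= y ^+ 3 by rewrite exprn_ge0.
  have : c * y <= c * (1 + c) by rewrite ler_wpM2l.
  lra.
have : (c * y <= y ^+ 3); last by nra.
by rewrite exprS mulrC ler_wpM2l// expr2; nra.
Qed.

(** Induction on [q] with [t] free: a further factor [|x| <= 1 + x^2 <= exp(x^2)] is absorbed by
    passing from [t] to [t + 1]. *)
Lemma poly_sextic_bounded q t : exists C, forall x,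
  `|q.[x]| * expR (- x ^+ 6 + t * x ^+ 2) <= C.
Proof.
elim/poly_ind: q t => [|q c IH] t.
  by exists 0 => x; rewrite horner0 normr0 mul0r.
have [C1 H1] := IH (t + 1); have [C2 H2] := sextic_bounded t.
exists (C1 + `|c| * C2) => x; rewrite hornerMXaddC.
apply: (le_trans (ler_wpM2r (expR_ge0 _) (ler_normD _ _))).
rewrite mulrDl lerD//; last by rewrite ler_wpM2l.
apply: le_trans (H1 x); rewrite normrM -mulrA ler_wpM2l//.
rewrite (_ : - x ^+ 6 + (t + 1) * x ^+ 2 = x ^+ 2 + (- x ^+ 6 + t * x ^+ 2));
  last by ring.
rewrite [leRHS]expRD ler_wpM2r ?expR_ge0//.
apply: le_trans (expR_ge1Dx _).
by rewrite -[x ^+ 2]real_normK ?num_real//; nra.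
Qed.

Context (lam : R).
Hypothesis lam_gt : -1 < lam.

Local Notation a := (2 * lam + 1).
(** Away from 0 this is a primitive of [(a + 1) |x|^a], and [|u x| = |x|^(a + 1)]. The exponent
    [a + 1] is positive since [-1 < lam], so [u] stays bounded near 0 even when [|x|^a] does not. *)
Let u x := x * `|x| `^ a.

Let a1_gt0 : 0 < a + 1.
Proof.
rewrite (_ : a + 1 = 2 * (lam + 1)); last by ring.
by rewrite mulr_gt0// -ltrBlDr sub0r.
Qed.

Let normr_u x : `|u x| = `|x| `^ (a + 1).
Proof.
rewrite /u normrM [`| _ `^ _|]ger0_norm ?powR_ge0// mulrC.
have [->|x0] := eqVneq x 0.
  by rewrite normr0 mulr0 powR0// gt_eqF.
rewrite (@powRD _ _ a 1); last by rewrite normr_eq0 x0 implybT.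
by rewrite powRr1.
Qed.

(** Any integer [m >= a + 1] works: the first summand covers [|x| <= 1], the second the rest. A
    polynomial bound brings [u] within reach of [poly_sextic_bounded]. *)
Let u_sqr_le : exists m, forall x, u x ^+ 2 <= 1 + x ^+ (2 * m).
Proof.
exists (Num.truncn (a + 1)).+1 => x.
set m := (Num.truncn _).+1.
have am : a + 1 <= m%:R by rewrite ltW// truncnS_gt.
rewrite exprM -[u x ^+ 2]real_normK ?num_real// normr_u.
have [x1|x1] := lerP `|x| 1.
  apply: (@le_trans _ _ 1); last by rewrite lerDl exprn_ge0// sqr_ge0.
  rewrite exprn_ile1 ?powR_ge0//.
  have [->|x0] := eqVneq x 0; first by rewrite normr0 powR0// gt_eqF.
  rewrite -[leRHS](powRr0 `|x|) ger_powR ?normr_gt0 ?x0//= ltW//.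
apply: (@le_trans _ _ ((`|x| ^+ m) ^+ 2)).
  rewrite ler_sqr ?nnegrE ?powR_ge0 ?exprn_ge0// -powR_mulrn//.
  by rewrite ler_powR// ltW.
by rewrite -exprM mulnC exprM real_normK ?num_real// lerDr.
Qed.

(* |q w| <= C g for the integrable function g = (atan o u)' below. *)
Let poly_u_bounded q t : exists C, forall x,
  `|q.[x]| * (1 + u x ^+ 2) * expR (- x ^+ 6 + t * x ^+ 2) <= C.
Proof.
have [m um] := u_sqr_le.
have [C HC] := poly_sextic_bounded (q * (2%:P + 'X^(2 * m))) t.
exists C => x; apply: le_trans (HC x).
rewrite ler_wpM2r ?expR_ge0// !hornerE normrM ler_wpM2l//.
rewrite (le_trans _ (ler_norm _))//.
by have := um x; lra.
Qed.

Let g x := (a + 1) * `|x| `^ a / (1 + u x ^+ 2).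

Let u2_gt0 x : 0 < 1 + u x ^+ 2.
Proof. by rewrite ltr_pwDl// sqr_ge0. Qed.

Let is_derive_u x : x != 0 -> is_derive x 1 u ((a + 1) * `|x| `^ a).
Proof.
move=> x0; have := is_deriveM (is_derive_id x 1) (is_derive_normr_powR a x0).
move=> d; apply: is_derive_eq d _; rewrite /GRing.scale /=; field; exact: x0.
Qed.

Let measurable_normr_powR : measurable_fun setT (fun x => `|x| `^ a).
Proof. exact: measurableT_comp (measurable_powR a) _. Qed.

(** The primitive [atan o u] is bounded by [pi / 2], which settles the singularity at 0 and the
    tails at once. *)
Let integrable_g : mu.-integrable setT (EFin \o g).
Proof.
have cu x : x != 0 -> {for x, continuous u}.
  by move=> x0; exact: is_derive_continuous (is_derive_u x0).
apply: (@bounded_primitive_integrable _ (atan \o u) g (pi / 2)).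
- apply: measurable_funM; first exact: measurable_funM.
  pose k (y : R) := (1 + y ^+ 2)^-1.
  apply: (@measurableT_comp _ _ _ _ _ _ k); last exact: measurable_funM.
  apply: continuous_measurable_fun => y; apply: cvgV.
    by rewrite gt_eqF// ltr_pwDl// sqr_ge0.
  by apply: cvgD; [exact: cvg_cst|exact: exprn_continuous].
- by move=> x; rewrite /g divr_ge0 ?mulr_ge0 ?powR_ge0 ?ltW.
- move=> x x0; have d := is_derive1_comp (is_derive1_atan (u x)) (is_derive_u x0).
  by apply: is_derive_eq d _; rewrite /g mulrC.
- move=> x x0; apply: cvgM.
    apply: cvgM; first exact: cvg_cst.
    exact: is_derive_continuous (is_derive_normr_powR a x0).
  apply: cvgV; first by rewrite gt_eqF.
  apply: cvgD; first exact: cvg_cst.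
  by apply: cvgM; exact: cu.
- move=> x /=; rewrite ler_norml (ltW (atan_ltpi2 _)) andbT.
  by rewrite ltW// atan_gtNpi2.
Qed.

Lemma measurable_freud q t :
  measurable_fun setT (fun x => q.[x] * freud_weight lam t x).
Proof.
apply: measurable_funM; first exact: measurable_poly.
apply: measurable_funM => //.
apply: measurableT_comp => //.
by apply: measurable_funD; [exact: measurableT_comp|exact: measurable_funM].
Qed.

Lemma integrable_freud q t :
  mu.-integrable setT (EFin \o (fun x => q.[x] * freud_weight lam t x)).
Proof.
have [C HC] := poly_u_bounded q t.
apply: (@le_integrable _ _ _ mu _ _ _
  (fun x => (C / (a + 1))%:E * (EFin \o g) x)%E).
- by [].
- apply/measurable_EFinP; exact: measurable_freud.
- move=> x _; rewrite /= lee_fin.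
  apply: le_trans (ler_norm _).
  rewrite /g /freud_weight !normrM [`| `|x| `^ _|]ger0_norm ?powR_ge0//.
  rewrite [`|expR _|]ger0_norm ?expR_ge0//.
  have := HC x; have := powR_ge0 `|x| a; have u2 := u2_gt0 x.
  move: (`|x| `^ a) => p p0 H.
  have -> : C / (a + 1) * ((a + 1) * p / (1 + u x ^+ 2)) =
      p * (C / (1 + u x ^+ 2)).
    by field; rewrite !gt_eqF.
  rewrite mulrCA ler_wpM2l// ler_pdivlMr//.
  by apply: le_trans H; rewrite mulrAC.
- exact: integrableZl.
Qed.

(** For the boundary terms at 0: the factor ['X] raises the exponent of [|x|] to [2 * lam + 2],
    which is positive. *)
Lemma freud_primitive_small q t : exists C, forall x,
  `|('X * q).[x] * freud_weight lam t x| <= C * `|x| `^ (2 * lam + 2).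
Proof.
have [C HC] := poly_sextic_bounded q t; exists C => x.
rewrite (_ : 2 * lam + 2 = a + 1); last by ring.
rewrite -normr_u /u /freud_weight hornerM hornerX !normrM.
rewrite [`|expR _|]ger0_norm ?expR_ge0// [leRHS]mulrC.
rewrite [leLHS](_ : _ = `|x| * `| `|x| `^ a| * (`|q.[x]|
  * expR (- x ^+ 6 + t * x ^+ 2))); last by ring.
by rewrite ler_wpM2l ?mulr_ge0.
Qed.

(** For the boundary terms at infinity, which are thus [O(1 / |x|)]. The bound follows from
    [|u| <= 1 + u^2]. *)
Lemma freud_primitive_decay q t : exists D, forall x,
  `|x| * `|('X * q).[x] * freud_weight lam t x| <= D.
Proof.
have [C HC] := poly_u_bounded ('X * q) t; exists C => x.
apply: le_trans (HC x).
have -> : `|x| * `|('X * q).[x] * freud_weight lam t x| =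
    `|('X * q).[x]| * `|u x| * expR (- x ^+ 6 + t * x ^+ 2).
  by rewrite /u /freud_weight !normrM [`|expR _|]ger0_norm ?expR_ge0//; ring.
rewrite ler_wpM2r ?expR_ge0// ler_wpM2l//.
by rewrite -[u x ^+ 2]real_normK ?num_real//; nra.
Qed.

End weight.

(** * The moment functional: its derivative in [t] and its Pearson relation *)

Section freud_functional.
Local Open Scope classical_set_scope.
Context {R : realType} (lam : R).
Hypothesis lam_gt : -1 < lam.
Let mu := @lebesgue_measure R.
Implicit Types (x t : R) (p q : {poly R}).

Definition freud_functional t p : R :=
  \int[mu]_x (p.[x] * freud_weight lam t x).

Lemma freud_functionalD t p q :
  freud_functional t (p + q) = freud_functional t p + freud_functional t q.
Proof.
rewrite /freud_functional -RintegralD//; [|exact: integrable_freud..].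
by apply: eq_Rintegral => x _; rewrite hornerD mulrDl.
Qed.

Lemma freud_functionalZ t (c : R) p :
  freud_functional t (c *: p) = c * freud_functional t p.
Proof.
rewrite /freud_functional -RintegralZl//; last exact: integrable_freud.
by apply: eq_Rintegral => x _; rewrite hornerZ -mulrA.
Qed.

Lemma is_derive_freud_functional t p :
  is_derive t 1 (fun s => freud_functional s p) (freud_functional t ('X^2 * p)).
Proof.
pose f s x := p.[x] * freud_weight lam s x.
have df (s x : R) :
    is_derive s 1 (f ^~ x) (('X^2 * p).[x] * freud_weight lam s x).
  have dE : is_derive s 1 (fun s : R => - x ^+ 6 + s * x ^+ 2) (x ^+ 2).
    have d := is_deriveD (is_derive_cst (- x ^+ 6) s 1)
      (is_deriveM (is_derive_id s 1) (is_derive_cst (x ^+ 2) s 1)).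
    by apply: is_derive_eq d _; rewrite /GRing.scale /=; ring.
  have d := is_deriveZ (p.[x] * `|x| `^ (2 * lam + 1))
    (is_derive1_comp (is_derive_expR _) dE).
  rewrite (_ : f ^~ x = (p.[x] * `|x| `^ (2 * lam + 1)) *:
      (expR \o (fun s : R => - x ^+ 6 + s * x ^+ 2))); last first.
    by apply/funext => r; rewrite /f /freud_weight mulrA.
  apply: is_derive_eq d _; rewrite !hornerE /freud_weight /GRing.scale /=.
  by ring.
have d1 s x : partial1of2 f s x = ('X^2 * p).[x] * freud_weight lam s x.
  by rewrite partial1of2E; have [_ ->] := df s x.
(* The weight is nondecreasing in its parameter, so its value at [t + 1] dominates on the whole
   window []t - 1, t + 1[]. *)
pose G x := `|('X^2 * p).[x] * freud_weight lam (t + 1) x|.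
have It : `]t - 1, t + 1[%classic t by rewrite /= in_itv /=; lra.
have intG : mu.-integrable setT (EFin \o G).
  apply: integrable_norm; exact: integrable_freud.
have G_ub s x : `]t - 1, t + 1[%classic s -> setT x ->
    `|partial1of2 f s x| <= G x.
  rewrite /= in_itv /= => /andP[_ st] _; rewrite d1 /G /freud_weight !normrM.
  rewrite !ler_wpM2l//.
  rewrite !ger0_norm ?expR_ge0// ler_expR lerD2l ler_wpM2r ?sqr_ge0//.
  exact: ltW.
have intf s : `]t - 1, t + 1[%classic s -> mu.-integrable setT (EFin \o f s).
  by move=> _; exact: integrable_freud.
have derf s x : `]t - 1, t + 1[%classic s -> setT x -> derivable (f ^~ x) s 1.
  by move=> _ _; have [] := df s x.
have G0 x : 0 <= G x by exact: normr_ge0.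
split.
  exact: (derivable_under_integral measurableT It intf derf G0 intG G_ub).
rewrite -derive1E.
rewrite (differentiation_under_integral measurableT It intf derf G0 intG G_ub).
by apply: eq_Rintegral => x _; rewrite d1.
Qed.

Lemma is_derive_weight t x : x != 0 ->
  is_derive x 1 (freud_weight lam t)
    (((2 * lam + 1) / x - 6 * x ^+ 5 + 2 * t * x) * freud_weight lam t x).
Proof.
move=> x0; pose e : {poly R} := - 'X^6 + t *: 'X^2.
have eE y : e.[y] = - y ^+ 6 + t * y ^+ 2.
  by rewrite hornerD hornerN hornerZ !hornerXn.
have deE : e^`().[x] = - 6 * x ^+ 5 + 2 * t * x.
  rewrite derivD derivN derivZ !derivXn.
  by rewrite !(hornerD, hornerN, hornerZ, hornerXn, hornerMn) /=; ring.
have wE : (fun y => `|y| `^ (2 * lam + 1)) * (expR \o horner e) =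
    freud_weight lam t.
  by apply/funext => y; rewrite /freud_weight fctE /= eE.
have := is_deriveM (is_derive_normr_powR (2 * lam + 1) x0)
  (is_derive1_comp (is_derive_expR _) (is_derive_poly e x)).
rewrite wE => d; apply: is_derive_eq d _.
by rewrite deE /GRing.scale /= eE /freud_weight; field.
Qed.

(** The factor [x] in the primitive [x p w] makes the boundary terms at 0 vanish, where [w] itself
    may blow up. *)
Lemma freud_pearson t p :
  freud_functional t ('X * p^`()) + (2 * lam + 2) * freud_functional t p =
  6 * freud_functional t ('X^6 * p) - 2 * t * freud_functional t ('X^2 * p).
Proof.
(* Chosen so that [q w = (x p w)']: the term [(2 lam + 1) / x] of [w' / w], multiplied by [x p],
   joins the [p] coming from [(x p)'] to give [(2 lam + 2) p]. *)
pose q := 'X * p^`() + (2 * lam + 2) *: p + (- 6) *: ('X^6 * p)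
  + (2 * t) *: ('X^2 * p).
suff : freud_functional t q = 0.
  rewrite /q !freud_functionalD !freud_functionalZ.
  by move=> E; apply/eqP; rewrite -subr_eq0 -E; apply/eqP; ring.
pose F x := ('X * p).[x] * freud_weight lam t x.
have cw x : x != 0 -> {for x, continuous (freud_weight lam t)}.
  by move=> x0; exact: is_derive_continuous (is_derive_weight t x0).
have [C HC] := freud_primitive_small lam_gt p t.
have [D HD] := freud_primitive_decay lam_gt p t.
have inv0 : (n.+2%:R^-1 : R) @[n --> \oo] --> (0 : R).
  by have := @cvg_harmonic R; rewrite -cvg_shiftS.
(* The sign [s] treats both half-lines at once. *)
have y0 (s : R) : `|s| = 1 -> F (s * n.+2%:R) @[n --> \oo] --> 0.
  move=> s1; apply: norm_cvg0.
  apply: (@squeeze_cvgr _ _ _ _ (cst 0) (fun n => D * n.+2%:R^-1)).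
  - apply: nearW => n; rewrite normr_ge0 /= ler_pdivlMr ?ltr0n//.
    have sn : `|s * n.+2%:R| = n.+2%:R by rewrite normrM s1 mul1r ger0_norm.
    by have := HD (s * n.+2%:R); rewrite sn mulrC.
  - exact: cvg_cst.
  - by rewrite -[X in _ --> X](mulr0 D); apply: cvgM => //; exact: cvg_cst.
have z0 (s : R) : `|s| = 1 -> F (s * n.+2%:R^-1) @[n --> \oo] --> 0.
  move=> s1; apply: norm_cvg0.
  apply: (@squeeze_cvgr _ _ _ _ (cst 0)
    (fun n => C * (n.+2%:R^-1) `^ (2 * lam + 2))).
  - apply: nearW => n; rewrite normr_ge0 /=.
    have sn : `|s * n.+2%:R^-1| = n.+2%:R^-1.
      by rewrite normrM s1 mul1r ger0_norm// invr_ge0.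
    by have := HC (s * n.+2%:R^-1); rewrite sn.
  - exact: cvg_cst.
  - rewrite -[X in _ --> X](mulr0 C); apply: cvgM; first exact: cvg_cst.
    have l0 : 0 < 2 * lam + 2 by move: lam_gt => l; lra.
    have /cvg_at_rightP := powR_cvg0 l0.
    by apply; split => // n; rewrite invr_gt0 ltr0n.
apply: (@integral_derivative_eq0 _ F).
- exact: integrable_freud.
- move=> x x0.
  have d := is_deriveM (is_derive_poly ('X * p) x) (is_derive_weight t x0).
  apply: is_derive_eq d _; rewrite /q derivM derivX /GRing.scale /=.
  rewrite !(hornerD, hornerZ, hornerM, hornerX, hornerXn, hornerC).
  by move: (freud_weight lam t x) => w; field.
- by move=> x x0; apply: cvgM; [exact: continuous_horner|exact: cw].
- by under eq_cvg do rewrite -[X in F X]mul1r; apply: y0; rewrite normr1.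
- by under eq_cvg do rewrite -[X in F X]mulN1r; apply: y0; rewrite normrN1.
- by under eq_cvg do rewrite -[X in F X]mul1r; apply: z0; rewrite normr1.
- by under eq_cvg do rewrite -[X in F X]mulN1r; apply: z0; rewrite normrN1.
Qed.

End freud_functional.

(** * Algebra of orthogonal polynomials for an abstract linear functional *)

Section orthogonal_polynomials.
Context {R : realType} (L : {poly R} -> R) (P : nat -> {poly R})
  (h b : nat -> R).
Hypothesis LD : forall p q, L (p + q) = L p + L q.
Hypothesis LZ : forall a p, L (a *: p) = a * L p.
Hypothesis monicP : forall n, P n \is monic /\ size (P n) = n.+1.
Hypothesis hgt0 : forall n, 0 < h n.
Hypothesis LP : forall m n, L (P m * P n) = h n * (m == n)%:R.
Hypothesis Pb : recurrence_coefficients P b.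

(** Subtracting the multiple of [P m] with the same top coefficient lowers the size of [q] and does
    not change the pairing with [P n]. *)
Lemma orthogonal_lower n (q : {poly R}) : (size q <= n)%N -> L (q * P n) = 0.
Proof.
(* The size bound [k] is decoupled from [n], which stays fixed during the induction. *)
suff aux k (r : {poly R}) : (size r <= k)%N -> (k <= n)%N -> L (r * P n) = 0.
  by move=> /aux; apply.
elim: k r => {q} [|m IH] q sq mn.
  move: sq; rewrite leqn0 size_poly_eq0 => /eqP ->.
  by rewrite mul0r -(scale0r 0) LZ mul0r.
have [monP sP] := monicP m.
rewrite -(subrK (q`_m *: P m) q) mulrDl LD -scalerAl LZ LP.
rewrite (ltn_eqF mn) !mulr0 addr0; apply: IH; last exact: ltnW.
apply/leq_sizeP => j; rewrite leq_eqVlt => /predU1P[<-|mj].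
  rewrite coefB coefZ; move: monP; rewrite monicE /lead_coef sP => /eqP ->.
  by rewrite mulr1 subrr.
rewrite coefB coefZ (nth_default _ (leq_trans sq mj)).
by rewrite [(P m)`_j]nth_default ?sP// mulr0 subrr.
Qed.

(* At n = 0 the truncated predecessor is harmless because b 0 = 0; the same
   holds wherever n.-1 or n.-1.-1 occurs below. *)
Lemma mulX_orthogonal n : 'X * P n = P n.+1 + b n *: P n.-1.
Proof.
case: Pb => b0 [P0 [P1 PS]]; case: n => [|n] /=.
  by rewrite b0 scale0r addr0 P1.
by rewrite PS subrK.
Qed.

Let LZl a p q : L ((a *: p) * q) = a * L (p * q).
Proof. by rewrite -scalerAl LZ. Qed.

Let LZr a p q : L (p * (a *: q)) = a * L (p * q).
Proof. by rewrite -scalerAr LZ. Qed.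

(** Both sides are [L(x P_n P_{n+1})], with [x] attached to one factor or to the other. *)
Lemma norm_ratio n : h n.+1 = b n.+1 * h n.
Proof.
have E : 'X * P n.+1 * P n = P n.+1 * ('X * P n) by ring.
have := congr1 L E; rewrite !mulX_orthogonal /= mulrDl mulrDr !LD.
rewrite LZl LZr !LP !eqxx.
rewrite (gtn_eqF (ltnW _)) ?ltnSn// gtn_eqF ?ltnS ?leq_pred//.
by rewrite !(mulr0, mulr1, add0r, addr0).
Qed.

(** The spare factor [b n] makes the relation [b_n h_{n-1} = h_n] valid at [n = 0] too. *)
Let mul_pred n : b n * (b n * h n.-1) = b n * h n.
Proof.
case: n => [|n]; last by rewrite -norm_ratio.
by case: Pb => -> _; rewrite !mul0r.
Qed.

(** The squared norm of [x P_n] is [h_{n+1} + b_n^2 h_{n-1}]; both terms are multiples of [h_n]. *)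
Lemma mulX2_norm n : L ('X^2 * P n ^+ 2) = (b n + b n.+1) * h n.
Proof.
have -> : 'X^2 * P n ^+ 2 = ('X * P n) * ('X * P n) by ring.
rewrite mulX_orthogonal !(mulrDl, mulrDr) !LD !(LZl, LZr) !LP.
rewrite !eqxx !mulr1 mul_pred norm_ratio gtn_eqF ?ltnS ?leq_pred//.
by rewrite ltn_eqF ?ltnS ?leq_pred//=; ring.
Qed.

(* L(x^5 P_n P_{n-1}) / h_{n-1} *)
Definition quintic_part n : R :=
  b n * (b n.-1.-1 * b n.-1 + b n.-1 ^+ 2 + 2 * b n.-1 * b n
    + b n.-1 * b n.+1 + b n ^+ 2 + 2 * b n * b n.+1 + b n.+1 ^+ 2
    + b n.+1 * b n.+2).

Lemma mulX2_orthogonal n :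
  'X^2 * P n = P n.+2 + (b n + b n.+1) *: P n + (b n * b n.-1) *: P n.-1.-1.
Proof.
have E : b n *: ('X * P n.-1) = b n *: (P n + b n.-1 *: P n.-1.-1).
  case: n => [|n]; last by rewrite mulX_orthogonal.
  by case: Pb => -> _; rewrite !scale0r.
rewrite (_ : 'X^2 * P n = 'X * ('X * P n)); last by ring.
rewrite mulX_orthogonal mulrDr -scalerAr E mulX_orthogonal /=.
by rewrite -!mul_polyC !(polyCD, polyCM); ring.
Qed.

Lemma mulX3_orthogonal n :
  'X^3 * P n = P n.+3 + (b n + b n.+1 + b n.+2) *: P n.+1
    + (b n * (b n.-1 + b n + b n.+1)) *: P n.-1
    + (b n * b n.-1 * b n.-1.-1) *: P n.-1.-1.-1.
Proof.
have E : (b n * b n.-1) *: ('X * P n.-1.-1) =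
    (b n * b n.-1) *: (P n.-1 + b n.-1.-1 *: P n.-1.-1.-1).
  case: Pb => b0 _; case: n => [|[|n]] /=.
  - by rewrite b0 mul0r !scale0r.
  - by rewrite b0 mulr0 !scale0r.
  - by rewrite mulX_orthogonal.
rewrite (_ : 'X^3 * P n = 'X * ('X^2 * P n)); last by ring.
rewrite mulX2_orthogonal !mulrDr -!scalerAr E !mulX_orthogonal /=.
by rewrite -!mul_polyC !(polyCD, polyCM); ring.
Qed.

(** This is the squared norm of [x^3 P_n], read off from its expansion in the orthogonal basis. *)
Lemma mulX6_norm n :
  L ('X^6 * P n ^+ 2) = (quintic_part n + quintic_part n.+1) * h n.
Proof.
have b0 : b 0%N = 0 by case: Pb.
have -> : 'X^6 * P n ^+ 2 = ('X^3 * P n) * ('X^3 * P n) by ring.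
have sq (p q r s : {poly R}) (c d e : R) :
    L ((p + c *: q + d *: r + e *: s) * (p + c *: q + d *: r + e *: s)) =
    L (p * p) + c ^+ 2 * L (q * q) + d ^+ 2 * L (r * r) + e ^+ 2 * L (s * s)
    + 2 * (c * L (q * p) + d * L (r * p) + e * L (s * p) + c * d * L (r * q)
           + c * e * L (s * q) + d * e * L (s * r)).
  rewrite !(mulrDl, mulrDr) !LD !(LZl, LZr).
  by rewrite [p * q]mulrC [p * r]mulrC [p * s]mulrC [q * r]mulrC [q * s]mulrC
    [r * s]mulrC; ring.
rewrite mulX3_orthogonal sq !LP /quintic_part.
(* For [n <= 2] some indices are truncated to 0 and may coincide, but the spurious terms carry a
   factor [b 0 = 0]. From 3 on the four indices are distinct and all cross terms vanish. *)
case: n => [|[|[|n]]] /=; rewrite ?b0 ?norm_ratio ?eqxx /=; try ring.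
rewrite !ltn_eqF /=; try by lia.
ring.
Qed.

(** The Euler operator multiplies [x^n] by [n], so [x P_n' - n P_n] has degree less than [n] and is
    orthogonal to [P_n]. *)
Lemma euler_norm n : L ('X * (P n ^+ 2)^`()) = 2 * n%:R * h n.
Proof.
have [monP sP] := monicP n.
have -> : 'X * (P n ^+ 2)^`() =
    (2 * n%:R) *: (P n * P n) + 2 *: (('X * (P n)^`() - n%:R *: P n) * P n).
  by rewrite expr2 derivM -!mul_polyC polyCM; ring.
rewrite LD !LZ LP eqxx orthogonal_lower ?mulr0 ?addr0 ?mulr1//.
apply/leq_sizeP => j; rewrite coefB coefZ coefXM coef_deriv.
case: j => [|j] /=; first by rewrite leqn0 => /eqP ->; rewrite mul0r subrr.
rewrite leq_eqVlt => /predU1P[->|nj]; first by rewrite mulr_natl subrr.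
by rewrite nth_default ?sP// mulr0 mul0rn subrr.
Qed.

Lemma string_equation (lam t : R) :
  (forall p, L ('X * p^`()) + (2 * lam + 2) * L p
     = 6 * L ('X^6 * p) - 2 * t * L ('X^2 * p)) ->
  forall n, 6 * quintic_part n - 2 * t * b n = n%:R + freud_gamma lam n.
Proof.
move=> pearson; elim=> [|n IH].
  by case: Pb => b0 _; rewrite /quintic_part /freud_gamma b0; ring.
have := pearson (P n ^+ 2).
rewrite euler_norm mulX6_norm mulX2_norm [P n ^+ 2]expr2 LP eqxx mulr1.
move=> E; suff : 6 * (quintic_part n + quintic_part n.+1)
    - 2 * t * (b n + b n.+1) = 2 * n%:R + (2 * lam + 2).
  (* The induction closes because [gamma_n + gamma_{n+1} = 2 lam + 1]. *)
  move: IH; rewrite /freud_gamma exprS -natr1; move: ((-1) ^+ n) => s.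
  by move=> IH S; apply/eqP; rewrite -subr_eq0; apply/eqP; lra.
by apply: (mulIf (lt0r_neq0 (hgt0 n))); rewrite [RHS]mulrDl E; ring.
Qed.
End orthogonal_polynomials.

(** * Dependence on [t]: the Volterra equation for the recurrence coefficients *)

Section toda_flow.
Context {R : realType} (L : R -> {poly R} -> R) (P : R -> nat -> {poly R})
  (h : R -> nat -> R) (b : nat -> R -> R).
Hypothesis LD : forall t p q, L t (p + q) = L t p + L t q.
Hypothesis LZ : forall t a p, L t (a *: p) = a * L t p.
Hypothesis monicP : forall t n, P t n \is monic /\ size (P t n) = n.+1.
Hypothesis hgt0 : forall t n, 0 < h t n.
Hypothesis LP : forall t m n, L t (P t m * P t n) = h t n * (m == n)%:R.
Hypothesis Pb : forall t, recurrence_coefficients (P t) (fun n => b n t).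
Hypothesis Lflow : forall (t : R) (p : {poly R}),
  is_derive t 1 (fun s => L s p) (L t ('X^2 * p)).

Let L0 t : L t 0 = 0.
Proof. by rewrite -(scale0r 0) LZ mul0r. Qed.

(* D plays the role of dP_n/dt; that its degree is less than n is what makes it
   orthogonal to P_n. *)
Let pairing_derivable (t : R) n := exists2 D : {poly R}, (size D <= n)%N &
  forall q : {poly R}, is_derive t 1 (fun s : R => L s (q * P s n))
    (L t ('X^2 * (q * P t n)) + L t (q * D)).

(** The variation of the functional contributes [L(x^2 P_n^2)]; that of [P_n] is orthogonal to
    [P_n]. *)
Let is_derive_norm t n : pairing_derivable t n ->
  is_derive t 1 (h ^~ n) ((b n t + b n.+1 t) * h t n).
Proof.
move=> [D sD dD].
(* One factor may be frozen at t: P_n(t) - P_n(s) has degree less than n. *)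
have hE : h ^~ n = fun s => L s (P t n * P s n).
  apply/funext => s; have [monP sP] := monicP s n.
  have [monPt sPt] := monicP t n.
  rewrite -(subrK (P s n) (P t n)) mulrDl LD.
  rewrite (orthogonal_lower (LD s) (LZ s) (monicP s) (LP s)) ?add0r.
    by rewrite LP eqxx mulr1.
  apply/leq_sizeP => j; rewrite leq_eqVlt => /predU1P[<-|nj].
    move: monP monPt; rewrite !monicE /lead_coef sP sPt coefB.
    by move=> /eqP -> /eqP ->; rewrite subrr.
  by rewrite coefB !nth_default ?sP ?sPt ?subrr.
rewrite hE; apply: is_derive_eq (dD (P t n)) _.
rewrite [P t n * D]mulrC.
rewrite (orthogonal_lower (LD t) (LZ t) (monicP t) (LP t) sD) addr0.
by rewrite -expr2 (mulX2_norm (LD t) (LZ t) (LP t) (Pb t)).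
Qed.

(** The coefficient is [h_{n+1} / h_n], so its logarithmic derivative is
    [(b_{n+1} + b_{n+2}) - (b_n + b_{n+1})]. *)
Let is_derive_coef t n : pairing_derivable t n -> pairing_derivable t n.+1 ->
  is_derive t 1 (b n.+1) (b n.+1 t * (b n.+2 t - b n t)).
Proof.
move=> /is_derive_norm dn /is_derive_norm dn1.
have ratio s : h s n.+1 = b n.+1 s * h s n.
  by rewrite (norm_ratio (LD s) (LZ s) (LP s) (Pb s)).
have h0 s m : h s m != 0 by rewrite gt_eqF.
have bE : b n.+1 = (h ^~ n.+1) * (fun s => (h s n)^-1).
  by apply/funext => s; rewrite /= !fctE ratio mulfK.
have := is_deriveM dn1 (is_deriveV (h0 t n) dn); rewrite -bE => db.
apply: is_derive_eq db _.
rewrite /GRing.scale /= ratio; field; exact: h0.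
Qed.

(** Two consecutive indices go through the induction together: to differentiate the recurrence for
    [P_{n+2}] one needs the derivative of [b_{n+1}], which comes from the norms at [n] and
    [n + 1]. *)
Let pairing_derivableP t n : pairing_derivable t n.
Proof.
suff: pairing_derivable t n /\ pairing_derivable t n.+1 by case.
elim: n => [|n [Sn Sn1]].
  (* [P_0] and [P_1] do not depend on [t], so their derivative is 0. *)
  split; exists 0; rewrite ?size_poly0// => q.
    have E : (fun s => L s (q * P s 0%N)) = fun s => L s q.
      by apply/funext => s; case: (Pb s) => _ [-> _]; rewrite mulr1.
    rewrite E; apply: is_derive_eq (Lflow t q) _.
    by case: (Pb t) => _ [-> _]; rewrite !mulr1 mulr0 L0 addr0.
  have E : (fun s => L s (q * P s 1%N)) = fun s => L s (q * 'X).
    by apply/funext => s; case: (Pb s) => _ [-> [-> _]]; rewrite mulr1.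
  rewrite E; apply: is_derive_eq (Lflow t _) _.
  case: (Pb t) => _ [P0 [-> _]].
  by rewrite P0 !mulr1 mulr0 L0 addr0.
split=> //; have db := is_derive_coef Sn Sn1.
case: Sn Sn1 => [D sD dD] [D1 sD1 dD1].
set c := b n.+1 t * (b n.+2 t - b n t) in db.
have PS s : P s n.+2 = 'X * P s n.+1 - b n.+1 s *: P s n.
  by case: (Pb s) => _ [_ [_ ->]].
(* The formal derivative of [x P_{n+1} - b_{n+1} P_n], where [c] is the derivative of [b_{n+1}]. *)
exists ('X * D1 - b n.+1 t *: D - c *: P t n).
  apply/leq_sizeP => j nj; have [_ sP] := monicP t n.
  rewrite !coefB !coefZ coefXM [D`_j]nth_default; last first.
    exact: leq_trans sD (ltnW (ltnW nj)).
  rewrite [(P t n)`_j]nth_default ?sP; last exact: ltnW.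
  case: j nj => // j nj; rewrite /= nth_default ?mulr0 ?subrr ?subr0//.
  exact: leq_trans sD1 nj.
move=> q.
have E : (fun s => L s (q * P s n.+2)) = (fun s => L s (q * 'X * P s n.+1)) -
    (b n.+1 * fun s => L s (q * P s n)).
  apply/funext => s; rewrite !fctE /= PS mulrBr -scalerAr -scaleN1r LD !LZ.
  by rewrite mulN1r !mulrA.
rewrite E; apply: is_derive_eq (is_deriveB (dD1 _) (is_deriveM db (dD q))) _.
rewrite /GRing.scale /= PS.
have -> : 'X^2 * (q * ('X * P t n.+1 - b n.+1 t *: P t n)) =
    'X^2 * (q * 'X * P t n.+1) + (- b n.+1 t) *: ('X^2 * (q * P t n)).
  by rewrite -!mul_polyC polyCN; ring.
have -> : q * ('X * D1 - b n.+1 t *: D - c *: P t n) =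
    q * 'X * D1 + ((- b n.+1 t) *: (q * D) + (- c) *: (q * P t n)).
  by rewrite -!mul_polyC !polyCN; ring.
by rewrite !LD !LZ; ring.
Qed.

Lemma is_derive_recurrence_coefficient (t : R) n :
  is_derive t 1 (b n) (b n t * (b n.+1 t - b n.-1 t)).
Proof.
case: n => [|n]; last exact: is_derive_coef.
have -> : b 0%N = cst 0 by apply/funext => s; case: (Pb s).
by rewrite /= mul0r; exact: is_derive_cst.
Qed.

End toda_flow.

(** * Elimination between the Volterra and the discrete equations *)

Section volterra_freud.
Context {R : realType} (b : nat -> R -> R) (lam : R).
Hypothesis b0 : forall t, b 0%N t = 0.
Hypothesis volterra : forall (t : R) n,
  is_derive t 1 (b n) (b n t * (b n.+1 t - b n.-1 t)).
Hypothesis string : forall t n,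
  6 * quintic_part (b ^~ t) n - 2 * t * b n t = n%:R + freud_gamma lam n.

Let derive1_b n : derive1 (b n) = fun t => b n t * (b n.+1 t - b n.-1 t).
Proof. by apply/funext => t; rewrite derive1E; apply: derive_val. Qed.

Let second_derivative (t : R) n : is_derive t 1 (derive1 (b n))
  (b n t * (b n.+1 t - b n.-1 t) ^+ 2
   + b n t * (b n.+1 t * (b n.+2 t - b n t)
              - b n.-1 t * (b n t - b n.-1.-1 t))).
Proof.
rewrite derive1_b.
have /= := is_deriveM (volterra t n)
  (is_deriveB (volterra t n.+1) (volterra t n.-1)).
move=> D; apply: is_derive_eq D _; rewrite /GRing.scale /= !fctE.
(* The index [n.-1.+1] produced by the derivative of [b n.-1] is [n] only for positive [n]; at 0
   everything is multiplied by [b 0 = 0]. *)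
case: n => [|n] /=; last by ring.
by rewrite b0; ring.
Qed.

Lemma volterra_twice_derivable n : twice_derivable (b n).
Proof.
move=> t; have [d1 _] := volterra t n; have [d2 _] := second_derivative t n.
by split.
Qed.

Lemma volterra_freud_system n t :
  derive1n 2 (b n) t - 3 * (b n t + b n.+1 t) * derive1 (b n) t
    + b n t ^+ 3 + 6 * b n t ^+ 2 * b n.+1 t
    + 3 * b n t * b n.+1 t ^+ 2 - 3^-1 * t * b n t
  = 6^-1 * (n%:R + freud_gamma lam n)
  /\
  derive1n 2 (b n.+1) t + 3 * (b n t + b n.+1 t) * derive1 (b n.+1) t
    + b n.+1 t ^+ 3 + 6 * b n.+1 t ^+ 2 * b n t
    + 3 * b n.+1 t * b n t ^+ 2 - 3^-1 * t * b n.+1 t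
  = 6^-1 * (n.+1%:R + freud_gamma lam n.+1).
Proof.
have d2 m : derive1n 2 (b m) t = b m t * (b m.+1 t - b m.-1 t) ^+ 2
   + b m t * (b m.+1 t * (b m.+2 t - b m t)
              - b m.-1 t * (b m t - b m.-1.-1 t)).
  by rewrite /= derive1E; have [_ ->] := second_derivative t m.
(* Once the right-hand sides are replaced by the discrete equations, the terms in [t] cancel and
   what remains are polynomial identities in the values of [b]. *)
rewrite !d2 -!(string t) /quintic_part !derive1_b /=.
by split; field.
Qed.

End volterra_freud.

Theorem lemma4p3 (R : realType) (lam : R) (hlam : -1 < lam)
    (P : R -> nat -> {poly R}) (h : R -> nat -> R) (beta : nat -> R -> R)
    (hP : forall t : R, monic_orthogonal (freud_weight lam t) (P t) (h t))
    (hbeta : forall t : R,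
      recurrence_coefficients (P t) (fun n => beta n t)) :
  forall n : nat,
    twice_derivable (beta n) /\
    twice_derivable (beta n.+1) /\
    forall t : R,
      derive1n 2 (beta n) t - 3 * (beta n t + beta n.+1 t) * derive1 (beta n) t
        + beta n t ^+ 3 + 6 * beta n t ^+ 2 * beta n.+1 t
        + 3 * beta n t * beta n.+1 t ^+ 2 - 3^-1 * t * beta n t
      = 6^-1 * (n%:R + freud_gamma lam n)
      /\
      derive1n 2 (beta n.+1) t + 3 * (beta n t + beta n.+1 t) * derive1 (beta n.+1) t
        + beta n.+1 t ^+ 3 + 6 * beta n.+1 t ^+ 2 * beta n t
        + 3 * beta n.+1 t * beta n t ^+ 2 - 3^-1 * t * beta n.+1 t
      = 6^-1 * (n.+1%:R + freud_gamma lam n.+1).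
Proof.
have LP t m n : freud_functional lam t (P t m * P t n) = h t n * (m == n)%:R.
  have [_ [_ /(_ m n) <-]] := hP t.
  by apply: eq_Rintegral => x _; rewrite hornerM.
have monicP t k : P t k \is monic /\ size (P t k) = k.+1 by case: (hP t).
have hgt0 t k : 0 < h t k by case: (hP t) => _ [].
have volterra := is_derive_recurrence_coefficient (freud_functionalD hlam)
  (freud_functionalZ hlam) monicP hgt0 LP hbeta
  (is_derive_freud_functional hlam).
have string t n := string_equation (freud_functionalD hlam t)
  (freud_functionalZ hlam t) (monicP t) (hgt0 t) (LP t) (hbeta t)
  (freud_pearson hlam t) n.
have b0 t : beta 0%N t = 0 by case: (hbeta t).
move=> n; split; last split.
- exact: (volterra_twice_derivable b0 volterra).
- exact: (volterra_twice_derivable b0 volterra).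
- by move=> t; exact: (volterra_freud_system b0 volterra string).
Qed.
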